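(* Let $m\ge2$ be an integer and $a,b,c$ positive integers. Then, for $z,u,v\in(-\infty,1)$, $$\tilde K_{a,b}(z;m+2)=a\,\tilde K_{a+1,b}(z;m)+b\,\tilde K_{a,b+1}(z;m),$$ $$\tilde H_{a,b,c}(u,v;m+2)=a\,\tilde H_{a+1,b,c}(u,v;m)+b\,\tilde H_{a,b+1,c}(u,v;m)+c\,\tilde H_{a,b,c+1}(u,v;m).$$
   Context: For positive integers $a,b,c,m$, $$\tilde K_{a,b}(u;m)=\frac{\Gamma(a+b+\frac m2-2)}{\Gamma(a+b)}\,{}_2F_1\big(a+b+\tfrac m2-2,\,b;\,a+b;\,u\big),$$ $$\tilde H_{a,b,c}(u,v;m)=\frac{\Gamma(a+b+c+\frac m2-2)}{\Gamma(a+b+c)}\,F_1\big(a+b+c+\tfrac m2-2;\,c,b;\,a+b+c;\,u,v\big).$$ ${}_2F_1$ is the Gauss hypergeometric function. $F_1$ is Appell's first hypergeometric function, $F_1(\alpha;\beta,\beta';\gamma;x,y)=\sum_{p,q\ge0}\frac{(\alpha)_{p+q}(\beta)_p(\beta')_q}{p!\,q!\,(\gamma)_{p+q}}x^py^q$ for $|x|,|y|<1$, extended to real $x,y<1$ (for $\beta,\beta',\gamma-\beta-\beta'>0$) by $$F_1(\alpha;\beta,\beta';\gamma;x,y)=\frac{\Gamma(\gamma)}{\Gamma(\beta)\Gamma(\beta')\Gamma(\gamma-\beta-\beta')}\int_{s,t\ge0,\,s+t\le1}s^{\beta-1}t^{\beta'-1}(1-s-t)^{\gamma-\beta-\beta'-1}(1-xs-yt)^{-\alpha}ds\,dt.$$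 *)

(* Defs.v *)
From mathcomp Require Export all_boot all_order all_algebra.
From mathcomp Require Export all_classical all_reals all_analysis.

Set Implicit Arguments.
Unset Strict Implicit.
Unset Printing Implicit Defensive.

Export Order.TTheory GRing.Theory Num.Theory.
Export numFieldNormedType.Exports.

Local Open Scope classical_set_scope.
Local Open Scope ring_scope.

(* Euler's integral: this is the Gamma function for 0 < x only, which covers
   every argument occurring in this file when a, b, c, m are positive. *)
Definition Gamma {R : realType} (x : R) : R :=
  \int[lebesgue_measure]_(t in `]0, +oo[) (t `^ (x - 1) * expR (- t)).

Definition pochhammer {R : realType} (x : R) (n : nat) : R :=
  \prod_(i < n) (x + i%:R).

Definition hyp2F1_series {R : realType} (alpha beta gamma x : R) : R :=
  limn (series (fun n =>
    pochhammer alpha n * pochhammer beta n / (n`!%:R * pochhammer gamma n)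
    * x ^+ n)).

Definition hyp2F1_integral {R : realType} (alpha beta gamma x : R) : R :=
  Gamma gamma / (Gamma beta * Gamma (gamma - beta)) *
  \int[lebesgue_measure]_(t in `[0, 1])
    (t `^ (beta - 1) * (1 - t) `^ (gamma - beta - 1)
     * (1 - x * t) `^ (- alpha)).

(* The hypergeometric series where it converges absolutely, and its analytic
   continuation along ]-oo, -1], given by Euler's integral; the latter is
   meaningful for x < 1 and 0 < beta < gamma. *)
Definition hyp2F1 {R : realType} (alpha beta gamma x : R) : R :=
  if `|x| < 1 then hyp2F1_series alpha beta gamma x
  else hyp2F1_integral alpha beta gamma x.

(* The double series converges absolutely when |x|, |y| < 1, so that it may be
   summed as an iterated series. *)
Definition appellF1_series {R : realType} (alpha beta beta' gamma x y : R) : R :=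
  limn (series (fun p => limn (series (fun q =>
    pochhammer alpha (p + q) * pochhammer beta p * pochhammer beta' q
    / (p`!%:R * q`!%:R * pochhammer gamma (p + q)) * x ^+ p * y ^+ q)))).

Definition appellF1_integral {R : realType}
    (alpha beta beta' gamma x y : R) : R :=
  Gamma gamma / (Gamma beta * Gamma beta' * Gamma (gamma - beta - beta')) *
  \int[(lebesgue_measure \x lebesgue_measure)%E]_(st in
      [set st : R * R | [/\ 0 <= st.1, 0 <= st.2 & st.1 + st.2 <= 1]])
    (st.1 `^ (beta - 1) * st.2 `^ (beta' - 1)
     * (1 - st.1 - st.2) `^ (gamma - beta - beta' - 1)
     * (1 - x * st.1 - y * st.2) `^ (- alpha)).

(* Outside the square |x|, |y| < 1, meaningful for x, y < 1 and
   beta, beta', gamma - beta - beta' > 0. *)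
Definition appellF1 {R : realType} (alpha beta beta' gamma x y : R) : R :=
  if (`|x| < 1) && (`|y| < 1) then appellF1_series alpha beta beta' gamma x y
  else appellF1_integral alpha beta beta' gamma x y.

Definition Ktilde {R : realType} (a b : nat) (u : R) (m : nat) : R :=
  Gamma ((a + b)%:R + m%:R / 2 - 2) / Gamma ((a + b)%:R) *
  hyp2F1 ((a + b)%:R + m%:R / 2 - 2) b%:R (a + b)%:R u.

Definition Htilde {R : realType} (a b c : nat) (u v : R) (m : nat) : R :=
  Gamma ((a + b + c)%:R + m%:R / 2 - 2) / Gamma ((a + b + c)%:R) *
  appellF1 ((a + b + c)%:R + m%:R / 2 - 2) c%:R b%:R (a + b + c)%:R u v.

(* Main.v *)
From mathcomp Require Import measurable_realfun ring lra.
Require Import Defs.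

(** Write N for a + b (respectively a + b + c) and alpha for N + m/2 - 1. The
    first argument of every hypergeometric function in the claim is this same
    alpha, and Gamma(alpha) is a common factor of all terms. Since
    Gamma(N + 1) = N Gamma(N), the two identities are the contiguous relations
      N 2F1(b; N) = a 2F1(b; N + 1) + b 2F1(b + 1; N + 1),
      N F1(c, b; N) = a F1(c, b; N + 1) + b F1(c, b + 1; N + 1)
                      + c F1(c + 1, b; N + 1)
    ([hyp2F1_contiguous], [appellF1_contiguous]). The choice
    between series and integral depends on the variables alone, so it is the
    same in all terms of a relation, and each representation can be treated
    separately.

    For the series the relation holds term by term
    ([gauss_term_contiguous], [appell_term_contiguous]): with n the total
    degree of the term, N/(N)_n = (N + n)/(N + 1)_n, and N + n is the sum of a
    and of the numbers b + q, c + p produced by b (b + 1)_q = (b + q) (b)_q.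
    Summing termwise requires the convergence of every series involved; it
    follows from a product of geometric bounds, [appell_term_bounded].

    For Euler's integrals the relation is the pointwise partition of unity
    1 = t + (1 - t), respectively 1 = s + t + (1 - s - t), inserted under the
    integral ([beta_integral_split], [dirichlet_integral_split]); the
    integrands are bounded on sets of finite measure, hence integrable. The
    coefficients a, b, c then come out of the Gamma prefactors, which are
    factorials by [GammaS]. *)

Set Implicit Arguments.
Unset Strict Implicit.
Unset Printing Implicit Defensive.

Local Open Scope classical_set_scope.
Local Open Scope ring_scope.

(** * Growth of the Pochhammer symbol *)

Section pochhammer.
Context {R : realType}.
Implicit Types (x r : R) (n : nat).

Lemma pochhammer0 x : pochhammer x 0 = 1.
Proof. by rewrite /pochhammer big_ord0. Qed.

Lemma pochhammerSr x n : pochhammer x n.+1 = pochhammer x n * (x + n%:R).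
Proof. by rewrite /pochhammer big_ord_recr. Qed.

Lemma pochhammer_shift x n :
  x * pochhammer (x + 1) n = pochhammer x n * (x + n%:R).
Proof.
rewrite -pochhammerSr /pochhammer big_ord_recl addr0; congr (_ * _).
by apply: eq_bigr => i _; rewrite lift0 -natr1; ring.
Qed.

Lemma pochhammerDr1 x n : 0 < x ->
  pochhammer (x + 1) n = pochhammer x n * (x + n%:R) / x.
Proof. by move=> x0; rewrite -pochhammer_shift mulrC mulKf// gt_eqF. Qed.

Lemma pochhammer_gt0 x n : 0 < x -> 0 < pochhammer x n.
Proof.
by move=> x0; apply: prodr_gt0 => i _; rewrite ltr_pwDl.
Qed.

Lemma fact_le_pochhammer x n : 1 <= x -> n`!%:R <= pochhammer x n.
Proof.
move=> x1; elim: n => [|n IH]; first by rewrite pochhammer0 fact0.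
rewrite pochhammerSr factS natrM mulrC ler_pM// -natr1.
by rewrite addrC lerD.
Qed.

(** The ratio of consecutive terms of (x)_n r^n / n! tends to r < 1, so the
    sequence eventually decreases, and the sum of its terms up to that point
    bounds it. *)
Lemma pochhammer_growth x r : 0 < x -> 0 < r < 1 ->
  exists2 M : R, 0 <= M & forall n, pochhammer x n * r ^+ n <= M * n`!%:R.
Proof.
move=> x0 /andP[r0 r1].
pose n0 := Num.bound (x / (1 - r)).
have n0P n : (n0 <= n)%N -> (x + n%:R) * r <= n.+1%:R.
  move=> le_n; have : x / (1 - r) <= n%:R.
    apply: le_trans (ltW (archi_boundP _)) _; last by rewrite ler_nat.
    by rewrite divr_ge0 ?subr_ge0 ?ltW.
  rewrite ler_pdivrMr ?subr_gt0// -natr1 => H.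
  have : x * r <= x by rewrite ler_piMr ?ltW.
  by move=> H'; lra.
pose c n := pochhammer x n * r ^+ n / n`!%:R.
have c0 n : 0 <= c n.
  by rewrite divr_ge0// mulr_ge0 ?exprn_ge0 ?ltW ?pochhammer_gt0.
have cE n : pochhammer x n * r ^+ n = c n * n`!%:R.
  by rewrite /c divfK// pnatr_eq0 -lt0n fact_gt0.
have cS n : (n0 <= n)%N -> c n.+1 <= c n.
  move=> /n0P le_n.
  have -> : c n.+1 = c n * ((x + n%:R) * r / n.+1%:R).
    rewrite /c pochhammerSr factS natrM exprS; field.
    by rewrite !pnatr_eq0 -!lt0n fact_gt0 addr_eq0 gt_eqF.
  by rewrite ler_piMr// ler_pdivrMr ?mul1r.
exists (\sum_(i < n0.+1) c i); first exact: sumr_ge0.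
move=> n; rewrite cE ler_wpM2r//.
have cle k : (k <= n0)%N -> c k <= \sum_(i < n0.+1) c i.
  move=> le_k; rewrite (bigD1 (Ordinal (le_k : (k < n0.+1)%N)))//=.
  by rewrite lerDl sumr_ge0.
have [/cle//|] := leqP n n0.
elim: n => // n IH; rewrite ltnS leq_eqVlt => /predU1P[<-|lt_n].
  exact: le_trans (cS _ (leqnn _)) (cle _ (leqnn _)).
exact: le_trans (cS _ (ltnW lt_n)) (IH lt_n).
Qed.

End pochhammer.

(** * Linearity of iterated series under a geometric bound *)

Section iterated_series.
Context {R : realType}.
Implicit Types (f g : nat -> nat -> R) (rho : R).

Lemma cvg_series_geometric_bound (u : R^nat) (C rho : R) : 0 <= rho < 1 ->
  (forall n, `|u n| <= C * rho ^+ n) ->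
  cvgn (series u) /\ `|limn (series u)| <= C / (1 - rho).
Proof.
move=> /andP[rho0 rho1] ub.
have nrho : `|rho| < 1 by rewrite ger0_norm.
have cg := cvg_geometric_series (a := C) nrho.
have cu : cvgn [normed series u].
  apply: (@series_le_cvg _ _ (geometric C rho)) (cvgP _ cg) => //= n.
  exact: le_trans (normr_ge0 _) (ub n).
split; first exact: normed_cvg.
apply: le_trans (lim_series_norm cu) _.
rewrite -(cvg_lim _ cg)//; apply: lim_series_le => //.
exact: cvgP cg.
Qed.

Definition iterated_series f : R :=
  limn (series (fun p => limn (series (f p)))).

(** A common ratio for both indices is kept as a parameter, so that the
    families bounded with a given ratio form a vector space. *)
Definition geometrically_bounded rho f :=
  exists C, forall p q, `|f p q| <= C * rho ^+ p * rho ^+ q.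

Lemma geometrically_boundedZ rho (k : R) f :
  geometrically_bounded rho f ->
  geometrically_bounded rho (fun p q => k * f p q).
Proof.
move=> [C fC]; exists (`|k| * C) => p q.
by rewrite normrM -!mulrA ler_wpM2l// mulrA.
Qed.

Lemma geometrically_boundedD rho f g :
  geometrically_bounded rho f -> geometrically_bounded rho g ->
  geometrically_bounded rho (fun p q => f p q + g p q).
Proof.
move=> [C fC] [D gD]; exists (C + D) => p q.
by rewrite !mulrDl; apply: le_trans (ler_normD _ _) _; rewrite lerD.
Qed.

(** The inner sums inherit the geometric bound C/(1 - rho) rho^p, so that the
    same comparison applies once more to the outer series. *)
Lemma geometrically_bounded_cvg rho f : 0 <= rho < 1 ->
  geometrically_bounded rho f ->
  (forall p, cvgn (series (f p))) /\
  cvgn (series (fun p => limn (series (f p)))).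
Proof.
move=> rho01 [C fC].
split=> [p|]; first by case: (cvg_series_geometric_bound rho01 (fC p)).
have b p : `|limn (series (f p))| <= C / (1 - rho) * rho ^+ p.
  rewrite mulrAC.
  by case: (cvg_series_geometric_bound rho01 (fC p)).
by case: (cvg_series_geometric_bound rho01 b).
Qed.

Lemma iterated_seriesZ rho (k : R) f : 0 <= rho < 1 ->
  geometrically_bounded rho f ->
  iterated_series (fun p q => k * f p q) = k * iterated_series f.
Proof.
move=> rho01 /(geometrically_bounded_cvg rho01)[cf cF].
rewrite /iterated_series; apply: etrans (lim_seriesZ k cF).
congr (limn (series _)); apply/funext => p.
exact: (lim_seriesZ k (cf p)).
Qed.

Lemma iterated_seriesD rho f g : 0 <= rho < 1 ->
  geometrically_bounded rho f -> geometrically_bounded rho g ->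
  iterated_series (fun p q => f p q + g p q) =
  iterated_series f + iterated_series g.
Proof.
move=> rho01 /(geometrically_bounded_cvg rho01)[cf cF].
move=> /(geometrically_bounded_cvg rho01)[cg cG].
rewrite /iterated_series; apply: etrans (lim_seriesD cF cG).
congr (limn (series _)); apply/funext => p.
exact: (lim_seriesD (cf p) (cg p)).
Qed.

End iterated_series.

(** * Contiguous relations between the series *)

Section hypergeometric_series.
Context {R : realType}.
Implicit Types (alpha beta gamma x y : R).

Definition appell_term alpha beta beta' gamma x y (p q : nat) : R :=
  pochhammer alpha (p + q) * pochhammer beta p * pochhammer beta' q
  / (p`!%:R * q`!%:R * pochhammer gamma (p + q)) * x ^+ p * y ^+ q.

Lemma appellF1_seriesE alpha beta beta' gamma x y :
  appellF1_series alpha beta beta' gamma x y =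
  iterated_series (appell_term alpha beta beta' gamma x y).
Proof. by []. Qed.

(** Over the common denominator (gamma)_(p+q+1), the right-hand coefficients
    become gamma - beta - beta', beta' + q and beta + p, whose sum is
    gamma + p + q. *)
Lemma appell_term_contiguous alpha beta beta' gamma x y p q :
  0 < beta -> 0 < beta' -> 0 < gamma ->
  gamma * appell_term alpha beta beta' gamma x y p q =
  (gamma - beta - beta') * appell_term alpha beta beta' (gamma + 1) x y p q
  + beta' * appell_term alpha beta (beta' + 1) (gamma + 1) x y p q
  + beta * appell_term alpha (beta + 1) beta' (gamma + 1) x y p q.
Proof.
move=> b0 b'0 g0; rewrite /appell_term.
rewrite !pochhammerDr1// natrD; field.
rewrite !(gt_eqF b0, gt_eqF b'0, gt_eqF g0)/=.
rewrite !pnatr_eq0 -!lt0n !fact_gt0 !gt_eqF ?pochhammer_gt0//.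
by rewrite -natrD ltr_pwDl.
Qed.

(** Each of (alpha)_(p+q)/(p+q)!, (beta)_p/p! and (beta')_q/q! grows at most
    like a power of 1/r for any r < 1, and gamma >= 1 allows (p+q)! to replace
    (gamma)_(p+q). Each index thus picks up two factors 1/r per step, which
    leaves a geometric decay as soon as |x| and |y| are smaller than r^2. The
    ratio depends on x and y only, so the four families of a contiguous
    relation share it. *)
Lemma appell_term_bounded x y : `|x| < 1 -> `|y| < 1 ->
  exists2 rho : R, 0 <= rho < 1 & forall alpha beta beta' gamma,
    0 < alpha -> 0 < beta -> 0 < beta' -> 1 <= gamma ->
    geometrically_bounded rho (appell_term alpha beta beta' gamma x y).
Proof.
move=> x1 y1; pose s : R := Num.max `|x| `|y|.
have s1 : s < 1 by rewrite gt_max x1.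
have s0 : 0 <= s by rewrite le_max normr_ge0.
(* By the arithmetic-geometric mean inequality, r^2 > s, as s < 1. *)
pose r : R := (1 + s) / 2.
have r01 : 0 < r < 1 by rewrite /r; lra.
have r0 : 0 < r by case/andP: r01.
pose rho : R := s / r ^+ 2.
have sE : s = rho * r ^+ 2 by rewrite /rho divfK// gt_eqF ?exprn_gt0.
have rho0 : 0 <= rho by rewrite divr_ge0 ?exprn_ge0 ?(ltW r0).
exists rho.
  rewrite rho0 ltr_pdivrMr ?exprn_gt0// mul1r -subr_gt0.
  have -> : r ^+ 2 - s = ((1 - s) / 2) ^+ 2 by rewrite /r; field.
  by rewrite exprn_gt0// divr_gt0 ?subr_gt0.
(* Kept transparent, r and rho would be unfolded by the algebra below. *)
clearbody rho r.
move=> alpha beta beta' gamma a0 b0 b'0 g1.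
have [A A0 AP] := pochhammer_growth a0 r01.
have [B B0 BP] := pochhammer_growth b0 r01.
have [B' B'0 B'P] := pochhammer_growth b'0 r01.
exists (A * B * B') => p q.
have g0 : 0 < gamma by apply: lt_le_trans g1.
have pos k : 0 < k`!%:R :> R by rewrite ltr0n fact_gt0.
have G := fact_le_pochhammer (p + q) g1.
have P := @pochhammer_gt0 R.
rewrite /appell_term !normrM normfV !normrM !normrX.
have Pn (z : R) n : 0 < z -> `|pochhammer z n| = pochhammer z n.
  by move=> z0; exact: gtr0_norm (P _ _ z0).
rewrite !Pn// !normr_nat.
set X := _ * _ * pochhammer beta' q.
have X0 : 0 <= X by rewrite !mulr_ge0// ltW// P.
have frac_le : X / (p`!%:R * q`!%:R * pochhammer gamma (p + q)) <=
    X / (p`!%:R * q`!%:R * (p + q)`!%:R).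
  rewrite ler_wpM2l// lef_pV2 ?posrE ?mulr_gt0 ?P ?pos//.
  by rewrite ler_wpM2l ?mulr_ge0.
have xs : `|x| ^+ p <= s ^+ p by rewrite lerXn2r ?nnegrE// le_max lexx.
have ys : `|y| ^+ q <= s ^+ q by rewrite lerXn2r ?nnegrE// le_max lexx orbT.
have frac0 : 0 <= X / (p`!%:R * q`!%:R * pochhammer gamma (p + q)).
  by rewrite divr_ge0// !mulr_ge0// ltW// P.
apply: (@le_trans _ _ (X / (p`!%:R * q`!%:R * (p + q)`!%:R)
    * s ^+ p * s ^+ q)).
  have e0 (z : R) n : 0 <= `|z| ^+ n by exact: exprn_ge0.
  have fe0 : 0 <= X / (p`!%:R * q`!%:R * pochhammer gamma (p + q)) * `|x| ^+ p.
    exact: mulr_ge0.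
  exact: ler_pM fe0 (e0 _ _) (ler_pM frac0 (e0 _ _) frac_le xs) ys.
have -> : X / (p`!%:R * q`!%:R * (p + q)`!%:R) * s ^+ p * s ^+ q =
  (pochhammer alpha (p + q) * r ^+ (p + q) / (p + q)`!%:R) *
  (pochhammer beta p * r ^+ p / p`!%:R) *
  (pochhammer beta' q * r ^+ q / q`!%:R) * (rho ^+ p * rho ^+ q).
  rewrite /X sE !exprMn exprD; field.
  by rewrite !gt_eqF.
rewrite -[leRHS]mulrA ler_wpM2r ?mulr_ge0 ?exprn_ge0//.
have P0 (z : R) n : 0 < z -> 0 <= pochhammer z n * r ^+ n / n`!%:R.
  by move=> z0; rewrite divr_ge0// mulr_ge0 ?exprn_ge0 ?(ltW (P _ _ _)) ?(ltW r0).
have PM (z M : R) n : pochhammer z n * r ^+ n <= M * n`!%:R ->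
    pochhammer z n * r ^+ n / n`!%:R <= M.
  by rewrite ler_pdivrMr.
have Pa := P0 _ (p + q)%N a0; have Pb := P0 _ p b0; have Pb' := P0 _ q b'0.
apply: (ler_pM (mulr_ge0 Pa Pb) Pb'); last exact: PM.
by apply: ler_pM Pa Pb _ _; exact: PM.
Qed.

Lemma appellF1_series_contiguous alpha beta beta' gamma x y :
  `|x| < 1 -> `|y| < 1 ->
  0 < alpha -> 0 < beta -> 0 < beta' -> 1 <= gamma ->
  gamma * appellF1_series alpha beta beta' gamma x y =
  (gamma - beta - beta') * appellF1_series alpha beta beta' (gamma + 1) x y
  + beta' * appellF1_series alpha beta (beta' + 1) (gamma + 1) x y
  + beta * appellF1_series alpha (beta + 1) beta' (gamma + 1) x y.
Proof.
move=> x1 y1 a0 b0 b'0 g1.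
have g0 : 0 < gamma by apply: lt_le_trans g1.
have [rho rho01 bnd] := appell_term_bounded x1 y1.
have B := bnd alpha _ _ _ a0 _ _ _.
rewrite !appellF1_seriesE.
have ? : 1 <= gamma + 1 by rewrite lerDr ltW.
have ? : 0 < beta + 1 by rewrite addr_gt0.
have ? : 0 < beta' + 1 by rewrite addr_gt0.
rewrite -!(iterated_seriesZ _ rho01) -?(iterated_seriesD rho01);
  do ?[exact: B | apply: geometrically_boundedD | apply: geometrically_boundedZ].
congr iterated_series; apply/funext => p; apply/funext => q.
exact: appell_term_contiguous.
Qed.

Definition gauss_term alpha beta gamma x (n : nat) : R :=
  pochhammer alpha n * pochhammer beta n / (n`!%:R * pochhammer gamma n)
  * x ^+ n.

(** Gauss terms are the Appell terms with q = 0, which transfers the geometric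
    bound to them. *)
Lemma gauss_termE alpha beta beta' gamma x n :
  gauss_term alpha beta gamma x n = appell_term alpha beta beta' gamma x 0 n 0.
Proof.
rewrite /gauss_term /appell_term addn0 pochhammer0 fact0 expr0.
by rewrite !mulr1.
Qed.

Lemma gauss_term_contiguous alpha beta gamma x n :
  0 < beta -> 0 < gamma ->
  gamma * gauss_term alpha beta gamma x n =
  (gamma - beta) * gauss_term alpha beta (gamma + 1) x n
  + beta * gauss_term alpha (beta + 1) (gamma + 1) x n.
Proof.
move=> b0 g0; rewrite /gauss_term !pochhammerDr1//; field.
rewrite (gt_eqF b0) (gt_eqF g0)/= pnatr_eq0 -lt0n fact_gt0.
by rewrite !gt_eqF ?pochhammer_gt0// ltr_pwDl.
Qed.

Lemma cvg_gauss_series alpha beta gamma x : `|x| < 1 ->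
  0 < alpha -> 0 < beta -> 1 <= gamma ->
  cvgn (series (gauss_term alpha beta gamma x)).
Proof.
move=> x1 a0 b0 g1.
have [|rho rho01 bnd] := @appell_term_bounded x 0 x1; first by rewrite normr0.
have [C CP] := bnd alpha beta 1 gamma a0 b0 ltr01 g1.
apply: (cvg_series_geometric_bound (C := C) rho01 _).1 => n.
by rewrite (gauss_termE _ _ 1); have := CP n 0%N; rewrite mulr1.
Qed.

Lemma hyp2F1_series_contiguous alpha beta gamma x : `|x| < 1 ->
  0 < alpha -> 0 < beta -> 1 <= gamma ->
  gamma * hyp2F1_series alpha beta gamma x =
  (gamma - beta) * hyp2F1_series alpha beta (gamma + 1) x
  + beta * hyp2F1_series alpha (beta + 1) (gamma + 1) x.
Proof.
move=> x1 a0 b0 g1.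
have g0 : 0 < gamma by apply: lt_le_trans g1.
have c0 := cvg_gauss_series x1 a0 b0 g1.
have c1 : cvgn (series (gauss_term alpha beta (gamma + 1) x)).
  by apply: cvg_gauss_series; rewrite // lerDr ltW.
have c2 : cvgn (series (gauss_term alpha (beta + 1) (gamma + 1) x)).
  by apply: cvg_gauss_series; rewrite // ?lerDr ?addr_gt0 ?ltW.
rewrite /hyp2F1_series -[LHS](lim_seriesZ gamma c0).
rewrite -[X in _ = X + _](lim_seriesZ (gamma - beta) c1).
rewrite -[X in _ = _ + X](lim_seriesZ beta c2).
rewrite -lim_seriesD; [|exact: is_cvg_seriesZ|exact: is_cvg_seriesZ].
congr (limn (series _)); apply/funext => n.
exact: gauss_term_contiguous.
Qed.

End hypergeometric_series.

(** * The Gamma integral at positive integers *)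

Section Gamma_nat.
Context {R : realType}.
Implicit Types (t : R) (n : nat).

(** The sum of all derivatives of X^n, so that - e^(-t) times it is a primitive
    of t^n e^(-t). With this explicit primitive, one application of the
    fundamental theorem of calculus on [0, +oo[ to a nonnegative integrand
    gives the value of Gamma. *)
Fixpoint gamma_poly n : {poly R} :=
  if n is k.+1 then 'X^(k.+1) + k.+1%:R *: gamma_poly k else 1.

Lemma horner_gamma_poly0 n : (gamma_poly n).[0] = n`!%:R.
Proof.
elim: n => [|n IH] /=; first by rewrite hornerE.
by rewrite hornerD hornerZ hornerXn IH expr0n /= add0r factS natrM.
Qed.

Lemma gamma_poly_deriv n : gamma_poly n - (gamma_poly n)^`() = 'X^n.
Proof.
elim: n => [|n IH] /=; first by rewrite -polyC1 derivC subr0 expr0.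
rewrite derivD derivXn derivZ /= -IH mulrnBl !scaler_nat.
by rewrite subrK addrK.
Qed.

Lemma is_derive_expRN_gamma_poly n t :
  is_derive t 1 (fun t => - (expR (- t) * (gamma_poly n).[t]))
    (t ^+ n * expR (- t)).
Proof.
have dp := is_derive_poly (gamma_poly n) t.
have dN : is_derive t 1 (fun t : R => expR (- t)) (- expR (- t)).
  have := is_derive1_comp (is_derive_expR (- t)) (is_deriveNid t 1).
  by move=> /is_derive_eq; apply; rewrite mulrN1.
have := is_deriveN (is_deriveM dN dp).
move=> /is_derive_eq; apply.
rewrite /GRing.scale/= -[t ^+ n]hornerXn -gamma_poly_deriv hornerD hornerN.
by ring.
Qed.

(** The exponential dominates the next term t^(n+1)/(n+1)! of its series, which
    leaves a bound (n+1)!/t. *)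
Lemma cvgy_expRN_exp n : expR (- t) * t ^+ n @[t --> +oo] --> (0 : R).
Proof.
apply/cvgrPdist_le => e e0; near=> t.
have t0 : 0 < t by near: t; apply: nbhs_pinfty_gt; exact: num_real.
rewrite sub0r normrN ger0_norm ?mulr_ge0 ?expR_ge0 ?exprn_ge0 ?(ltW t0)//.
rewrite expRN mulrC ler_pdivrMr ?expR_gt0//.
have := @expR_ge1Dxn _ t n (ltW t0).
have : n.+1`!%:R / e <= t by near: t; apply: nbhs_pinfty_ge; exact: num_real.
rewrite ler_pdivrMr// => h1 h2.
have h3 : t ^+ n.+1 / n.+1`!%:R <= expR t.
  by apply: le_trans h2; rewrite lerDr.
apply: (@le_trans _ _ (e * (t ^+ n.+1 / n.+1`!%:R))); last first.
  by rewrite ler_wpM2l// ltW.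
rewrite mulrA ler_pdivlMr ?ltr0n ?fact_gt0// exprSr [X in _ <= X]mulrCA.
by rewrite ler_wpM2l ?exprn_ge0 ?(ltW t0)// mulrC.
Unshelve. all: by end_near. Qed.

Lemma cvgy_expRN_gamma_poly n :
  expR (- t) * (gamma_poly n).[t] @[t --> +oo] --> (0 : R).
Proof.
elim: n => [|n IH] /=.
  rewrite (_ : (fun _ => _) = (fun t => expR (- t) * t ^+ 0)).
    exact: cvgy_expRN_exp.
  by apply/funext => t; rewrite hornerE.
rewrite (_ : (fun _ => _) = (fun t => expR (- t) * t ^+ n.+1 +
   n.+1%:R * (expR (- t) * (gamma_poly n).[t]))); last first.
  by apply/funext => t; rewrite hornerD hornerZ hornerXn; ring.
rewrite -[0 in X in _ --> X](addr0 0) -[X in _ --> _ + X](mulr0 n.+1%:R).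
by apply: cvgD; [exact: cvgy_expRN_exp | apply: cvgMl_tmp].
Qed.

Lemma GammaS n : Gamma (n.+1%:R : R) = n`!%:R.
Proof.
rewrite /Gamma.
transitivity (\int[lebesgue_measure]_(t in `]0%R, +oo[)
    (t ^+ n * expR (- t : R))).
  apply: eq_Rintegral => t; rewrite inE/= in_itv/= andbT => t0.
  by rewrite -natr1 addrK powR_mulrn ?ltW.
pose F t := - (expR (- t) * (gamma_poly n).[t]).
have dF t : derivable F t 1 by case: (is_derive_expRN_gamma_poly n t).
have cf : continuous (fun t : R => t ^+ n * expR (- t)).
  move=> t; apply: cvgM; first exact: exprn_continuous.
  apply: (@continuous_comp _ _ _ (fun t : R => - t) expR).
    exact: opp_continuous.
  exact: continuous_expR.
rewrite /Rintegral integral_itv_obnd_cbnd; last first.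
  apply/measurable_EFinP; apply: measurable_funTS.
  exact: continuous_measurable_fun.
rewrite -/(Rintegral _ _ _) (@Rintegral_ge0_continuous_FTC2y _ _ F 0 0).
- by rewrite /F oppr0 expR0 mul1r horner_gamma_poly0 sub0r opprK.
- by move=> t t0; rewrite mulr_ge0 ?exprn_ge0 ?expR_ge0.
- exact: continuous_subspaceT.
- rewrite -[0]oppr0; apply: cvgN; exact: cvgy_expRN_gamma_poly.
- by move=> t _; exact: dF.
- apply: cvg_at_right_filter.
  by apply: differentiable_continuous; exact/derivable1_diffP/dF.
- move=> t _; rewrite derive1E; apply: derive_val.
  exact: is_derive_expRN_gamma_poly.
Qed.
End Gamma_nat.

(** * Euler's integrals *)

Section bounded_integrals.
Context d (T : measurableType d) (R : realType).
Variable mu : {measure set T -> \bar R}.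

Lemma bounded_by_integrable (D : set T) (f : T -> R) (M : R) :
  measurable D -> (mu D < +oo)%E -> measurable_fun D f ->
  (forall x, D x -> `|f x| <= M) -> mu.-integrable D (EFin \o f).
Proof.
move=> mD Dfin mf fM; apply: measurable_bounded_integrable => //.
exists M; split; first exact: num_real.
by move=> N MN x Dx /=; exact: le_trans (fM _ Dx) (ltW MN).
Qed.

End bounded_integrals.

Section Euler_integrals.
Context {R : realType}.
Implicit Types (alpha x y : R).
Local Notation mu := (@lebesgue_measure R).
Local Notation mu2 := (mu \x mu)%E.

Lemma lebesgue_measure_itv01 : mu `[0, 1] = 1%E.
Proof. by rewrite lebesgue_measure_itv/= lte01 oppr0 adde0. Qed.

Lemma normrM_le1 (a b M : R) : `|a| <= 1 -> `|b| <= M -> `|a * b| <= M.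
Proof. by move=> a1 bM; rewrite normrM -[leRHS]mul1r ler_pM. Qed.

Lemma normrX_le1 (a : R) n : 0 <= a <= 1 -> `|a ^+ n| <= 1.
Proof.
by move=> /andP[a0 a1]; rewrite normrX ger0_norm// exprn_ile1.
Qed.

(** The factor (1 - xt)^(-alpha) of Euler's integrals is bounded because its
    base stays away from 0. *)
Lemma powRN_le alpha delta w : 0 <= alpha -> 0 < delta :> R -> delta <= w ->
  `|w `^ (- alpha)| <= delta `^ (- alpha).
Proof.
move=> a0 d0 dw; rewrite ger0_norm ?powR_ge0// !powRN.
have w0 : 0 < w by exact: lt_le_trans dw.
by rewrite lef_pV2 ?posrE ?powR_gt0// ge0_ler_powR ?nnegrE// ltW.
Qed.

(** Euler's integral for 2F1 at integer parameters, with the exponents of t and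
    of 1 - t counted by natural numbers: the relations below shift them by
    one. *)
Definition beta_integral (i j : nat) alpha x : R :=
  \int[mu]_(t in `[0, 1]) (t ^+ i * (1 - t) ^+ j * (1 - x * t) `^ (- alpha)).

(** As an affine function of t in [0, 1], 1 - xt is at least the smaller of its
    end values 1 and 1 - x. *)
Lemma beta_integrable i j alpha x : 0 <= alpha -> x < 1 ->
  mu.-integrable `[0, 1]
    (EFin \o (fun t => t ^+ i * (1 - t) ^+ j * (1 - x * t) `^ (- alpha))).
Proof.
move=> a0 x1; pose delta := Num.min 1 (1 - x).
have d0 : 0 < delta by rewrite lt_min ltr01 subr_gt0.
apply: (@bounded_by_integrable _ _ _ _ _ _ (delta `^ (- alpha))) => //.
- by apply: (le_lt_trans (y := 1%E));
    [rewrite -lebesgue_measure_itv01 | exact: ltry].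
- apply: measurable_funTS; apply: measurable_funM.
    apply: measurable_funM; apply: measurable_funX => //.
    exact: measurable_funB.
  apply: (measurableT_comp (measurable_powR _)).
  by apply: measurable_funB => //; apply: measurable_funM.
move=> t; rewrite /= in_itv/= => /andP[t0 t1].
apply: normrM_le1; first by apply: normrM_le1; apply: normrX_le1; lra.
apply: powRN_le => //.
have [d1 dx] : delta <= 1 /\ delta <= 1 - x.
  by rewrite /delta !ge_min !lexx orbT.
nra.
Qed.

Lemma beta_integral_split i j alpha x : 0 <= alpha -> x < 1 ->
  beta_integral i j alpha x =
  beta_integral i j.+1 alpha x + beta_integral i.+1 j alpha x.
Proof.
move=> a0 x1; rewrite /beta_integral -RintegralD//; last 2 first.
- exact: beta_integrable.
- exact: beta_integrable.
by apply: eq_Rintegral => t _; rewrite !exprS; ring.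
Qed.

Definition simplex : set (R * R) :=
  [set st | [/\ 0 <= st.1, 0 <= st.2 & st.1 + st.2 <= 1]].

Lemma measurable_simplex :
  measurable (simplex : set (measurableTypeR R * measurableTypeR R)).
Proof.
pose A := (fst : R * R -> R) @^-1` `[0, +oo[.
pose B := (snd : R * R -> R) @^-1` `[0, +oo[.
pose C := (fun st : R * R => st.1 + st.2) @^-1` `]-oo, 1].
have -> : simplex = A `&` B `&` C.
  by apply/seteqP; split=> st; rewrite /simplex /A /B /C /= !in_itv/= ?andbT;
    [move=> [] | move=> [[]]].
have pre (f : R * R -> R) (i : interval R) : measurable_fun setT f ->
    measurable (f @^-1` [set` i]).
  by move=> mf; rewrite -[X in measurable X]setTI; exact: mf.
apply: measurableI; last by apply: pre; exact: measurable_funD.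
by apply: measurableI; apply: pre.
Qed.

Lemma simplex_finite : (mu2 simplex < +oo)%E.
Proof.
apply: (@le_lt_trans _ _ (mu2 (`[0%R, 1%R] `*` `[0%R, 1%R]))%E).
  apply: le_measure; rewrite ?inE; [exact: measurable_simplex| |].
    exact: measurableX.
  move=> st [s0 t0 st1] /=; rewrite !in_itv/= s0 t0/=.
  by split; lra.
rewrite product_measure1E//.
by rewrite [X in (X * X)%E]lebesgue_measure_itv01 mule1 ltry.
Qed.

Definition dirichlet_integral (i j k : nat) alpha x y : R :=
  \int[mu2]_(st in simplex) (st.1 ^+ i * st.2 ^+ j * (1 - st.1 - st.2) ^+ k
    * (1 - x * st.1 - y * st.2) `^ (- alpha)).

(** On the simplex, 1 - xs - yt is the barycentric combination
    (1 - s - t) + s (1 - x) + t (1 - y) of its values at the vertices, hence at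
    least the smallest of 1, 1 - x, 1 - y. *)
Lemma dirichlet_integrable i j k alpha x y :
  0 <= alpha -> x < 1 -> y < 1 ->
  mu2.-integrable simplex (EFin \o (fun st : R * R =>
    st.1 ^+ i * st.2 ^+ j * (1 - st.1 - st.2) ^+ k
    * (1 - x * st.1 - y * st.2) `^ (- alpha))).
Proof.
move=> a0 x1 y1; pose delta := Num.min 1 (Num.min (1 - x) (1 - y)).
have d0 : 0 < delta by rewrite !lt_min ltr01 !subr_gt0 x1.
apply: (@bounded_by_integrable _ _ _ _ _ _ (delta `^ (- alpha))).
- exact: measurable_simplex.
- exact: simplex_finite.
- apply: measurable_funTS; apply: measurable_funM.
    do 2?apply: measurable_funM; apply: measurable_funX => //.
    by do 2?apply: measurable_funB.
  apply: (measurableT_comp (measurable_powR _)).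
  by do 2?[apply: measurable_funB => //]; apply: measurable_funM.
move=> st [s0 t0 st1].
apply: normrM_le1.
  by do 2?[apply: normrM_le1]; apply: normrX_le1; lra.
apply: powRN_le => //.
have [d1 dx dy] : [/\ delta <= 1, delta <= 1 - x & delta <= 1 - y].
  by rewrite /delta !ge_min !lexx !orbT.
nra.
Qed.

Lemma dirichlet_integral_split i j k alpha x y :
  0 <= alpha -> x < 1 -> y < 1 ->
  dirichlet_integral i j k alpha x y =
  dirichlet_integral i j k.+1 alpha x y + dirichlet_integral i j.+1 k alpha x y
  + dirichlet_integral i.+1 j k alpha x y.
Proof.
move=> a0 x1 y1; rewrite /dirichlet_integral.
have m := measurable_simplex.
have int i' j' k' := dirichlet_integrable i' j' k' a0 x1 y1.
rewrite -RintegralD// -RintegralD//.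
  by apply: eq_Rintegral => t _; rewrite !exprS; ring.
exact: (integrableD m (int _ _ _) (int _ _ _)).
Qed.

End Euler_integrals.

(** * Contiguous relations and the theorem *)

Section contiguous_relations.
Context {R : realType}.
Implicit Types (alpha x y : R) (a b c : nat).

Lemma natr_subr1 n : n.+1%:R - 1 = n%:R :> R.
Proof. by rewrite -natr1 addrK. Qed.

Lemma hyp2F1_integralE a b alpha x :
  hyp2F1_integral alpha b.+1%:R (a.+1 + b.+1)%:R x =
  (a + b).+1`!%:R / (a`!%:R * b`!%:R) * beta_integral b a alpha x.
Proof.
rewrite /hyp2F1_integral /beta_integral natrD addrK natr_subr1 -natrD addSn addnS !GammaS.
rewrite [b`!%:R * _]mulrC; congr (_ * _).
apply: eq_Rintegral => t; rewrite inE/= in_itv/= => /andP[t0 t1].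
by rewrite natr_subr1 !powR_mulrn ?subr_ge0.
Qed.

(** Raising an exponent of the integrand by one multiplies the denominator of
    the Gamma prefactor by a+1 or b+1, and its numerator by N: these are the
    coefficients that turn the partition 1 = (1 - t) + t into the relation. *)
Lemma hyp2F1_integral_contiguous a b alpha x : 0 <= alpha -> x < 1 ->
  (a.+1 + b.+1)%:R * hyp2F1_integral alpha b.+1%:R (a.+1 + b.+1)%:R x =
  a.+1%:R * hyp2F1_integral alpha b.+1%:R (a.+2 + b.+1)%:R x
  + b.+1%:R * hyp2F1_integral alpha b.+2%:R (a.+1 + b.+2)%:R x.
Proof.
move=> a0 x1; rewrite !hyp2F1_integralE (beta_integral_split _ _ a0 x1).
have f0 n : n`!%:R != 0 :> R by rewrite pnatr_eq0 -lt0n fact_gt0.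
have s0 n : n.+1%:R != 0 :> R by rewrite pnatr_eq0.
rewrite !addSn !addnS !(factS (a + b).+1) !(factS a) !(factS b) !natrM.
by field; rewrite !f0 !(addrC 1) !natr1 !s0.
Qed.

Lemma appellF1_integralE a b c alpha x y :
  appellF1_integral alpha c.+1%:R b.+1%:R (a.+1 + b.+1 + c.+1)%:R x y =
  (a + b + c).+2`!%:R / (a`!%:R * b`!%:R * c`!%:R)
  * dirichlet_integral c b a alpha x y.
Proof.
rewrite /appellF1_integral /dirichlet_integral.
have -> : (a.+1 + b.+1 + c.+1)%:R - c.+1%:R - b.+1%:R = a.+1%:R :> R.
  by rewrite !natrD !addrK.
have -> : (a.+1 + b.+1 + c.+1 = (a + b + c).+3)%N by rewrite !(addSn, addnS).
rewrite !GammaS.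
congr (_ * _); first by congr (_ / _); ring.
apply: eq_Rintegral => st; rewrite inE => -[s0 t0 st1].
by rewrite !natr_subr1 !powR_mulrn// -addrA -opprD subr_ge0.
Qed.

Lemma appellF1_integral_contiguous a b c alpha x y :
  0 <= alpha -> x < 1 -> y < 1 ->
  (a.+1 + b.+1 + c.+1)%:R
    * appellF1_integral alpha c.+1%:R b.+1%:R (a.+1 + b.+1 + c.+1)%:R x y =
  a.+1%:R * appellF1_integral alpha c.+1%:R b.+1%:R (a.+2 + b.+1 + c.+1)%:R x y
  + b.+1%:R
    * appellF1_integral alpha c.+1%:R b.+2%:R (a.+1 + b.+2 + c.+1)%:R x y
  + c.+1%:R
    * appellF1_integral alpha c.+2%:R b.+1%:R (a.+1 + b.+1 + c.+2)%:R x y.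
Proof.
move=> a0 x1 y1.
rewrite !appellF1_integralE (dirichlet_integral_split _ _ _ a0 x1 y1).
have f0 n : n`!%:R != 0 :> R by rewrite pnatr_eq0 -lt0n fact_gt0.
have s0 n : n.+1%:R != 0 :> R by rewrite pnatr_eq0.
rewrite !(addSn, addnS) !(factS (a + b + c).+2) !(factS a) !(factS b).
rewrite !(factS c) !natrM.
by field; rewrite !f0 !(addrC 1) !natr1 !s0.
Qed.

Lemma hyp2F1_contiguous a b alpha x :
  (0 < a)%N -> (0 < b)%N -> 0 < alpha -> x < 1 ->
  (a + b)%:R * hyp2F1 alpha b%:R (a + b)%:R x =
  a%:R * hyp2F1 alpha b%:R (a.+1 + b)%:R x
  + b%:R * hyp2F1 alpha b.+1%:R (a + b.+1)%:R x.
Proof.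
case: a => // a _; case: b => // b _ alpha0 x1; rewrite /hyp2F1.
case: ifPn => [nx1|_]; last by rewrite hyp2F1_integral_contiguous ?ltW.
rewrite hyp2F1_series_contiguous//; last by rewrite addSn ler1n.
by rewrite natr1 -addSn [b.+1%:R + 1]natr1 -[in X in _ = _ + X]addSnnS
  [in X in X * _ + _]natrD addrK.
Qed.

Lemma appellF1_contiguous a b c alpha x y :
  (0 < a)%N -> (0 < b)%N -> (0 < c)%N -> 0 < alpha -> x < 1 -> y < 1 ->
  (a + b + c)%:R * appellF1 alpha c%:R b%:R (a + b + c)%:R x y =
  a%:R * appellF1 alpha c%:R b%:R (a.+1 + b + c)%:R x y
  + b%:R * appellF1 alpha c%:R b.+1%:R (a + b.+1 + c)%:R x y
  + c%:R * appellF1 alpha c.+1%:R b%:R (a + b + c.+1)%:R x y.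
Proof.
case: a => // a _; case: b => // b _; case: c => // c _ alpha0 x1 y1.
rewrite /appellF1; case: ifPn => [/andP[nx1 ny1]|_]; last first.
  by rewrite appellF1_integral_contiguous ?ltW.
rewrite appellF1_series_contiguous//; last by rewrite !addSn ler1n.
have -> : (a.+1 + b.+1 + c.+1)%:R - c.+1%:R - b.+1%:R = a.+1%:R :> R.
  by rewrite !natrD !addrK.
by rewrite !natr1 !(addSn, addnS).
Qed.

End contiguous_relations.

Theorem proposition2p7 (R : realType) (m a b c : nat) (z u v : R) :
  (2 <= m)%N -> (0 < a)%N -> (0 < b)%N -> (0 < c)%N ->
  z < 1 -> u < 1 -> v < 1 ->
  Ktilde a b z (m + 2) =
    a%:R * Ktilde a.+1 b z m + b%:R * Ktilde a b.+1 z m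
  /\
  Htilde a b c u v (m + 2) =
    a%:R * Htilde a.+1 b c u v m + b%:R * Htilde a b.+1 c u v m
    + c%:R * Htilde a b c.+1 u v m.
Proof.
move=> m2 a0 b0 c0 z1 u1 v1.
have GammaSE n : (0 < n)%N -> Gamma (n.+1%:R : R) = n%:R * Gamma n%:R.
  by case: n => // n _; rewrite !GammaS factS natrM.
have Gamma_neq0 n : (0 < n)%N -> Gamma (n%:R : R) != 0.
  by case: n => // n _; rewrite GammaS pnatr_eq0 -lt0n fact_gt0.
have exponentE n : n.+1%:R + m%:R / 2 - 2 = n%:R + (m + 2)%:R / 2 - 2 :> R.
  by rewrite -natr1 natrD; field.
have exponent_gt0 n : (2 <= n)%N -> 0 < n%:R + (m + 2)%:R / 2 - 2 :> R.
  move=> n2; have : 2 <= n%:R :> R by rewrite ler_nat.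
  have : 2 <= m%:R :> R by rewrite ler_nat.
  by rewrite natrD; lra.
split.
- have N0 : (0 < a + b)%N by rewrite addn_gt0 a0.
  have N2 : (2 <= a + b)%N by rewrite (leq_add a0 b0).
  have NR0 : (a + b)%:R != 0 :> R by rewrite pnatr_eq0 -lt0n.
  have /(canRL (mulKf NR0)) H := hyp2F1_contiguous a0 b0 (exponent_gt0 _ N2) z1.
  rewrite /Ktilde H (addnS a b) addSn exponentE GammaSE//.
  by field; rewrite -!natrD NR0 Gamma_neq0.
- have N0 : (0 < a + b + c)%N by rewrite !addn_gt0 a0.
  have N2 : (2 <= a + b + c)%N by rewrite (leq_trans (leq_add a0 b0)) ?leq_addr.
  have NR0 : (a + b + c)%:R != 0 :> R by rewrite pnatr_eq0 -lt0n.
  have /(canRL (mulKf NR0)) H :=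
    appellF1_contiguous a0 b0 c0 (exponent_gt0 _ N2) u1 v1.
  rewrite /Htilde H !(addnS a, addnS (a + b), addSn) exponentE GammaSE//.
  by field; rewrite -!natrD NR0 Gamma_neq0.
Qed.
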